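(* Let $\Phi$ be a CNF formula on variables $x_1,\dots,x_n$ in which every clause contains between $k$ and $6k$ distinct variables and every variable appears in at most $d$ clauses, and let $x$ be a variable. Suppose that $\log d \geq 5\log k + 20$ and $k \geq 50\log d + 50\log k + 250$. Run the coupling procedure described in the context on $\Phi$ and $x$, and let $V_I$ be the final set. Then for every positive integer $t$, $$\Pr\big[|V_I| \geq 2(6dk)^2 t\big] \leq \Big(\frac{1}{2}\Big)^t.$$
   Context: Logarithms are base $2$. A CNF formula need not be monotone. Coupling procedure: first fix a labeling of the variables as marked/unmarked such that every clause has at least $k/4$ marked and at least $k/4$ unmarked variables (such a labeling exists under the hypotheses). The procedure maintains two partial assignments $\mathcal{A}_1,\mathcal{A}_2$ (always setting the same set of variables), a partition $V_I\cup V_O$ of the variables, and a set of remaining clauses (initially all clauses). For $i=1,2$, $\mathcal{D}_i$ denotes the uniform distribution on satisfying assignments of $\Phi$ consistent with the current $\mathcal{A}_i$ (the conditional probabilities are given exactly by an oracle). Initially $\mathcal{A}_1(x)=T$, $\mathcal{A}_2(x)=F$, $V_I=\{x\}$, $V_O$ = all other variables. While there is a remaining clause $c$ with a variable in $V_I$ and a variable in $V_O$ (chosen by a fixed deterministic rule): its unset marked variables are set one at a time; to set $y$, let $p_i=\Pr_{\mathcal{D}_i}[y=T]$ and choose $(\mathcal{A}_1(y),\mathcal{A}_2(y))$ to be $(T,T)$ with probability $\min(p_1,p_2)$, $(F,F)$ with probability $\min(1-p_1,1-p_2)$, and otherwise $(T,F)$ if $p_1>p_2$ or $(F,T)$ if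 $p_1\le p_2$. Then: Case 1, if $c$ is satisfied by the variables already set in $\mathcal{A}_1$ and also in $\mathcal{A}_2$, let $S$ be the variables of $c$ with different values in $\mathcal{A}_1$ and $\mathcal{A}_2$, set $V_I\leftarrow V_I\cup S$, $V_O\leftarrow V_O\setminus S$, and delete $c$; Case 2, otherwise, let $S$ be all variables of $c$ and set $V_I\leftarrow V_I\cup S$, $V_O\leftarrow V_O\setminus S$. The procedure ends when no such clause exists. *)

(* Defs.v *)
From HB Require Import structures.
From mathcomp Require Import all_boot all_order all_algebra.
From mathcomp Require Import reals exp.

Set Implicit Arguments.
Unset Strict Implicit.
Unset Printing Implicit Defensive.

Import Order.TTheory GRing.Theory Num.Theory.
Local Open Scope ring_scope.

Definition log2 (R : realType) (x : R) : R := ln x / ln 2.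

(* The literal (v, b) is true under an assignment sending v to b. *)
Definition clause (n : nat) := {set 'I_n * bool}.

(* Clauses are indexed by 'I_m, so equal clauses may be repeated. *)
Definition cnf (n m : nat) := 'I_m -> clause n.

Definition vars (n : nat) (c : clause n) : {set 'I_n} := [set l.1 | l in c].

Definition assignment (n : nat) := {ffun 'I_n -> bool}.
Definition passignment (n : nat) := {ffun 'I_n -> option bool}.

Definition satisfies (n m : nat) (Phi : cnf n m) (s : assignment n) : bool :=
  [forall j, exists l in Phi j, s l.1 == l.2].

Definition psat (n : nat) (c : clause n) (a : passignment n) : bool :=
  [exists l in c, a l.1 == Some l.2].

Definition consistent (n : nat) (a : passignment n) (s : assignment n) : bool :=
  [forall v, (a v == None) || (a v == Some (s v))].

Definition solutions (n m : nat) (Phi : cnf n m) (a : passignment n) :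
    {set assignment n} :=
  [set s | satisfies Phi s & consistent a s].

(* Probability that y is true under the uniform distribution on
   [solutions Phi a]; it is 0 by convention if there are no solutions. *)
Definition prob_true (R : realType) (n m : nat) (Phi : cnf n m)
    (a : passignment n) (y : 'I_n) : R :=
  #|[set s in solutions Phi a | s y]|%:R / #|solutions Phi a|%:R.

(* Laws on a finite type are represented by their mass functions. *)
Definition dirac (R : realType) (T : finType) (x : T) : {ffun T -> R} :=
  [ffun y => (y == x)%:R].

Definition bind (R : realType) (T U : finType) (mu : {ffun T -> R})
    (f : T -> {ffun U -> R}) : {ffun U -> R} :=
  [ffun u => \sum_(x : T) mu x * f x u].

Definition Pr (R : realType) (T : finType) (mu : {ffun T -> R})
    (E : pred T) : R :=
  \sum_(x | E x) mu x.

Definition pset (n : nat) (a : passignment n) (y : 'I_n) (b : bool) :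
    passignment n :=
  [ffun v => if v == y then Some b else a v].

Definition pset2 (n : nat) (a : passignment n * passignment n) (y : 'I_n)
    (b1 b2 : bool) : passignment n * passignment n :=
  (pset a.1 y b1, pset a.2 y b2).

Definition couple_var (R : realType) (n m : nat) (Phi : cnf n m) (y : 'I_n)
    (a : passignment n * passignment n) :
    {ffun passignment n * passignment n -> R} :=
  let p1 := prob_true R Phi a.1 y in
  let p2 := prob_true R Phi a.2 y in
  let qTT := Num.min p1 p2 in
  let qFF := Num.min (1 - p1) (1 - p2) in
  let other := if p2 < p1 then pset2 a y true false
               else pset2 a y false true in
  [ffun a' => qTT * dirac R (pset2 a y true true) a'
            + qFF * dirac R (pset2 a y false false) a'
            + (1 - qTT - qFF) * dirac R other a'].

Fixpoint couple_vars (R : realType) (n m : nat) (Phi : cnf n m)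
    (ys : seq 'I_n) (a : passignment n * passignment n) :
    {ffun passignment n * passignment n -> R} :=
  if ys is y :: ys' then bind (couple_var R Phi y a) (couple_vars R Phi ys')
  else dirac R a.

(* ((A_1, A_2), V_I, remaining clauses); V_O is the complement of V_I. *)
Definition state (n m : nat) :=
  (passignment n * passignment n * {set 'I_n} * {set 'I_m})%type.

Definition asg (n m : nat) (s : state n m) : passignment n * passignment n :=
  s.1.1.
Definition VI (n m : nat) (s : state n m) : {set 'I_n} := s.1.2.
Definition VO (n m : nat) (s : state n m) : {set 'I_n} := ~: VI s.
Definition remaining (n m : nat) (s : state n m) : {set 'I_m} := s.2.

Definition eligible (n m : nat) (Phi : cnf n m) (s : state n m) :
    {set 'I_m} :=
  [set j in remaining s | (vars (Phi j) :&: VI s != set0)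
                       && (vars (Phi j) :&: VO s != set0)].

(* A rule selecting the clause treated next, [None] meaning that the loop
   stops. *)
Definition valid_clause_rule (n m : nat) (Phi : cnf n m)
    (next_clause : state n m -> option 'I_m) : Prop :=
  forall s, match next_clause s with
            | Some j => j \in eligible Phi s : Prop
            | None => eligible Phi s = set0
            end.

(* The two partial assignments always set the same variables, hence looking
   at the first one suffices. *)
Definition unset_marked (n m : nat) (Phi : cnf n m) (marked : {set 'I_n})
    (s : state n m) (j : 'I_m) : {set 'I_n} :=
  [set v in vars (Phi j) | (v \in marked) && ((asg s).1 v == None)].

Definition valid_var_order (n m : nat) (Phi : cnf n m) (marked : {set 'I_n})
    (var_order : state n m -> 'I_m -> seq 'I_n) : Prop :=
  forall s j, perm_eq (var_order s j) (enum (unset_marked Phi marked s j)).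

Definition update (n m : nat) (Phi : cnf n m) (s : state n m) (j : 'I_m)
    (a : passignment n * passignment n) : state n m :=
  if psat (Phi j) a.1 && psat (Phi j) a.2 then
    (a, VI s :|: [set v in vars (Phi j) | a.1 v != a.2 v], remaining s :\ j)
  else (a, VI s :|: vars (Phi j), remaining s).

Definition step (R : realType) (n m : nat) (Phi : cnf n m)
    (next_clause : state n m -> option 'I_m)
    (var_order : state n m -> 'I_m -> seq 'I_n)
    (s : state n m) : {ffun state n m -> R} :=
  if next_clause s is Some j then
    bind (couple_vars R Phi (var_order s j) (asg s))
      (fun a => dirac R (update Phi s j a))
  else dirac R s.

Definition init (n m : nat) (x : 'I_n) : state n m :=
  (pset2 ([ffun=> None], [ffun=> None]) x true false, [set x], [set: 'I_m]).

(* No clause is treated twice, so m iterations of the loop reach the end of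
   the procedure: see [final_law_stopped] below. *)
Definition final_law (R : realType) (n m : nat) (Phi : cnf n m) (x : 'I_n)
    (next_clause : state n m -> option 'I_m)
    (var_order : state n m -> 'I_m -> seq 'I_n) : {ffun state n m -> R} :=
  iter m (fun mu => bind mu (step R Phi next_clause var_order))
    (dirac R (init m x)).

Definition todo (n m : nat) (Phi : cnf n m) (s : state n m) : {set 'I_m} :=
  [set j in remaining s | ~~ (vars (Phi j) \subset VI s)].

Lemma eligible_todo (n m : nat) (Phi : cnf n m) (s : state n m) :
  eligible Phi s \subset todo Phi s.
Proof.
apply/subsetP=> j; rewrite !inE => /and3P[-> _ /set0Pn[v]].
rewrite !inE => /andP[jv nv]; apply: contra nv => /subsetP; exact.
Qed.

Lemma todo_update (n m : nat) (Phi : cnf n m) (s : state n m) (j : 'I_m) a :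
  j \in eligible Phi s -> (#|todo Phi (update Phi s j a)| < #|todo Phi s|)%N.
Proof.
move=> /(subsetP (eligible_todo Phi s)) js; apply/proper_card/properP; split.
  apply/subsetP=> i; rewrite !inE /update; case: ifP => _ /andP[].
    rewrite !inE => /andP[_ ->]; apply: contra => /subset_trans; apply.
    exact: subsetUl.
  move=> ->; apply: contra => /subset_trans; apply; exact: subsetUl.
exists j => //; rewrite !inE /update; case: ifP => _; rewrite /= ?inE ?eqxx //.
by rewrite subsetUr andbF.
Qed.

Lemma final_law_stopped (R : realType) (n m : nat) (Phi : cnf n m) (x : 'I_n)
    (next_clause : state n m -> option 'I_m)
    (var_order : state n m -> 'I_m -> seq 'I_n) (s : state n m) :
  valid_clause_rule Phi next_clause ->
  final_law R Phi x next_clause var_order s != 0 -> eligible Phi s = set0.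
Proof.
move=> hrule; rewrite /final_law; set run := iter _ _ _ => run_s.
suff inv N s' : iter N (fun mu => bind mu (step R Phi next_clause var_order))
    (dirac R (init m x)) s' != 0 ->
    (eligible Phi s' == set0) || (N + #|todo Phi s'| <= m)%N.
  case/orP: (inv m s run_s) => [/eqP //|].
  rewrite -[leqRHS]addn0 leq_add2l leqn0 cards_eq0 => /eqP t0.
  by apply/eqP; rewrite -subset0 -t0 eligible_todo.
elim: N s' => [|N IH] s' /=.
  move=> _; rewrite add0n (leq_trans (max_card _)) ?orbT //.
  by rewrite card_ord.
rewrite ffunE; apply: contraR; rewrite negb_or => /andP[ns' big].
apply/eqP/big1 => u _; apply/eqP; rewrite mulf_eq0.
have [//|/IH hu /=] := eqVneq; have := hrule u; rewrite /step.
case: (next_clause u) => [j ju|el0].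
  rewrite ffunE; apply/eqP/big1 => a _; rewrite ffunE.
  have [eq_s'|] := eqVneq; last by rewrite mulr0.
  have /negPf ne0 : eligible Phi u != set0 by apply/set0Pn; exists j.
  move: hu big; rewrite ne0 /= eq_s' => hu /negP[].
  by rewrite addSnnS (leq_trans _ hu) // leq_add2l todo_update.
rewrite ffunE; have [eq_s'|//] := eqVneq s' u.
by move: ns'; rewrite eq_s' el0 eqxx.
Qed.

(* Main.v *)
Require Import Defs.
From mathcomp Require Import all_boot all_order all_algebra.
From mathcomp Require Import reals exp.
From mathcomp Require Import zify ring lra.

(** The procedure only ever sets marked variables and x, so every clause keeps
about k/4 unset variables and the Lovasz local lemma shows that each variable
is set to either value with probability 1/2 up to a tiny e. Call a clause bad
if it contains a variable other than x on which the two assignments disagree,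
or if all its marked variables are set and one of the two assignments does not
satisfy it. The probability that prescribed pairwise disjoint clauses all become
bad is bounded by the product of their potentials, which is a supermartingale:
a variable lies in at most one of the clauses.

Every variable of V_I other than x lies in a bad clause, and each bad clause met
by the procedure contains x or shares a variable with an earlier one. Keeping
greedily those that are disjoint from the ones already kept gives disjoint bad
clauses, the first one containing x and each later one within distance two of an
earlier one. At least t of them are kept when V_I is large, and they are
covered by a walk of 2(t - 1) steps of distance two; a union bound over such
walks concludes. *)

Set Implicit Arguments.
Unset Strict Implicit.
Unset Printing Implicit Defensive.

Import Order.TTheory GRing.Theory Num.Theory.
Local Open Scope ring_scope.

(** * Local lemma by counting *)

Definition flip (n : nat) (v : 'I_n) (s : assignment n) : assignment n :=
  [ffun w => if w == v then ~~ s w else s w].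

Lemma flipK (n : nat) (v : 'I_n) : involutive (flip v).
Proof.
by move=> s; apply/ffunP=> w; rewrite !ffunE; case: eqP => //; rewrite negbK.
Qed.

(** [flip v] is a bijection of [P] onto itself that exchanges the two values of [v], so each value
    takes exactly half of [P]. *)
Lemma card_flip (n : nat) (P : {set assignment n}) (v : 'I_n) (b : bool) :
  (forall s, (flip v s \in P) = (s \in P)) ->
  (2 * #|[set s in P | s v == b]| = #|P|)%N.
Proof.
move=> inv_P; rewrite -(cardsID [set s : assignment n | s v == b] P).
rewrite mul2n -addnn; congr (_ + _)%N; first by apply: eq_card => s; rewrite !inE.
rewrite -(card_imset _ (inv_inj (@flipK n v))); apply: eq_card => s.
rewrite -[s in RHS](flipK v) mem_imset ?inE; last exact: inv_inj (@flipK n v).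
by rewrite inv_P ffunE eqxx andbC; case: (s v) b => -[].
Qed.

Lemma card_fix (n : nat) (P : {set assignment n}) (w : 'I_n -> bool)
    (W : seq 'I_n) :
  uniq W -> (forall v, v \in W -> forall s, (flip v s \in P) = (s \in P)) ->
  (2 ^ size W * #|[set s in P | all (fun v => s v == w v) W]| = #|P|)%N.
Proof.
elim: W => [|v W IH] /=.
  by move=> _ _; rewrite mul1n; apply: eq_card => s; rewrite !inE andbT.
move=> /andP[nvW uW] inv_P; rewrite -(IH uW) => [|v' v'W]; last first.
  by apply: inv_P; rewrite inE v'W orbT.
rewrite expnSr -mulnA; congr (_ * _)%N.
rewrite -[RHS](@card_flip _ _ v (w v)) => [|s].
  congr (2 * _)%N; apply: eq_card => s; rewrite !inE -andbA.
  by rewrite [(s v == _) && _]andbC.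
rewrite !inE inv_P ?mem_head //; congr (_ && _); apply: eq_in_all => v' v'W.
by rewrite ffunE ifN //; apply: contra nvW => /eqP <-.
Qed.

Definition csat (n : nat) (c : clause n) (s : assignment n) : bool :=
  [exists l in c, s l.1 == l.2].

(** Only the clauses of [S] are imposed, so that the local lemma can be proved by induction on
    [S]. *)
Definition sat_on (n m : nat) (Phi : cnf n m) (a : passignment n)
    (S : {set 'I_m}) : {set assignment n} :=
  [set s | consistent a s & [forall j in S, csat (Phi j) s]].

Definition violating (n m : nat) (Phi : cnf n m) (a : passignment n)
    (S : {set 'I_m}) (j : 'I_m) : {set assignment n} :=
  [set s in sat_on Phi a S | ~~ csat (Phi j) s].

Definition meets (n m : nat) (Phi : cnf n m) (i j : 'I_m) : bool :=
  ~~ [disjoint vars (Phi i) & vars (Phi j)].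

Definition unset (n : nat) (a : passignment n) : {set 'I_n} :=
  [set v | a v == None].

Section LocalLemma.
Context (n m : nat) (Phi : cnf n m) (a : passignment n).

Lemma solutionsE : solutions Phi a = sat_on Phi a setT.
Proof.
apply/setP=> s; rewrite !inE andbC; congr (_ && _).
by apply: eq_forallb => j; rewrite inE.
Qed.

Lemma consistent_flip v s :
  v \in unset a -> consistent a (flip v s) = consistent a s.
Proof.
rewrite inE => /eqP av; apply: eq_forallb => w; rewrite ffunE.
by case: (w =P v) => // ->; rewrite av.
Qed.

Lemma csat_flip (c : clause n) v s : v \notin vars c -> csat c (flip v s) = csat c s.
Proof.
move=> nvc; apply: eq_existsb => l; case lc: (l \in c) => //=.
rewrite ffunE ifN //; apply: contra nvc => /eqP <-; exact: imset_f.
Qed.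

Lemma sat_on_flip (S : {set 'I_m}) v s :
  v \in unset a -> (forall j, j \in S -> v \notin vars (Phi j)) ->
  (flip v s \in sat_on Phi a S) = (s \in sat_on Phi a S).
Proof.
move=> va nvS; rewrite !inE consistent_flip //; congr (_ && _).
apply: eq_forallb => j; case jS: (j \in S) => //=.
by rewrite csat_flip // nvS.
Qed.

(** A violated clause makes all its literals false, which determines its variables. A clause holding
    both literals of a variable is never violated, so the positive literal alone decides the
    value. *)
Lemma csatN (c : clause n) s v : ~~ csat c s -> v \in vars c -> s v = ((v, true) \notin c).
Proof.
move=> /existsPn unsat /imsetP[[w b] /= lc ->].
have := unsat (w, b); rewrite lc /=; case: b lc => lc.
  by rewrite lc eqb_id => /negbTE ->.
case: (s w) (unsat (w, true)) => //=.
by rewrite andbT => /negbTE ->.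
Qed.

Lemma sat_onS (S1 S2 : {set 'I_m}) :
  S1 \subset S2 -> sat_on Phi a S2 \subset sat_on Phi a S1.
Proof.
move=> /subsetP s12; apply/subsetP=> s; rewrite !inE => /andP[-> /=].
move=> /forall_inP all_sat; apply/forall_inP => j /s12; exact: all_sat.
Qed.

(** No clause of [S] sees the unset variables of [j], so these are free in [sat_on Phi a S], whereas
    a violation of [j] prescribes all of them. *)
Lemma violating_disjoint (S : {set 'I_m}) j :
  (forall i, i \in S -> ~~ meets Phi i j) ->
  (2 ^ #|vars (Phi j) :&: unset a| * #|violating Phi a S j|
     <= #|sat_on Phi a S|)%N.
Proof.
move=> disjS; set W := vars (Phi j) :&: unset a.
rewrite -(@card_fix _ (sat_on Phi a S) (fun v => (v, true) \notin Phi j) (enum W)).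
- rewrite -cardE leq_mul2l subset_leq_card ?orbT //; apply/subsetP=> s.
  rewrite inE => /andP[sS unsat]; rewrite inE sS /=; apply/allP=> v.
  by rewrite mem_enum inE => /andP[vj _]; rewrite (csatN unsat vj).
- exact: enum_uniq.
- move=> v; rewrite mem_enum inE => /andP[vj va] s.
  apply: sat_on_flip => // i /disjS; rewrite negbK => dij; by rewrite (disjointFl dij vj).
Qed.

Lemma sat_on_union_bound (S1 S2 : {set 'I_m}) :
  (#|sat_on Phi a S2| <=
     #|sat_on Phi a (S1 :|: S2)| + \sum_(i in S1) #|violating Phi a S2 i|)%N.
Proof.
apply: (@leq_trans #|sat_on Phi a (S1 :|: S2)
                   :|: \bigcup_(i in S1) violating Phi a S2 i|).
  apply/subset_leq_card/subsetP=> s sS2; rewrite inE.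
  case sU: (s \in _) => //=; move: sU sS2.
  rewrite !inE => + /andP[sa /forall_inP sS2]; rewrite sa /= => /negbT.
  move=> /forallPn[i]; rewrite negb_imply !inE => /andP[iU unsat].
  apply/bigcupP; exists i; last by rewrite !inE sa unsat andbT; apply/forall_inP.
  by case/orP: iU => // /sS2; rewrite (negbTE unsat).
rewrite (leq_trans (leq_card_setU _ _)) // leq_add2l.
elim/big_rec2: _ => [|i A B _ le_AB]; first by rewrite cards0.
by rewrite (leq_trans (leq_card_setU _ _)) // leq_add2l.
Qed.

Context (u D : nat).
Hypothesis unset_ge : forall j, (u <= #|vars (Phi j) :&: unset a|)%N.
Hypothesis degree_le : forall j, (#|[set i | meets Phi i j]| <= D)%N.
Hypothesis D_le : (4 * D <= 2 ^ u)%N.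

(* Clauses meeting j are removed from S, which makes the violation of j
   independent of the rest; by induction their removal at most doubles the
   number of assignments. *)
Lemma local_lemma (S : {set 'I_m}) j :
  (2 ^ u * #|violating Phi a S j| <= 2 * #|sat_on Phi a S|)%N.
Proof.
have [N] := ubnP #|S|; elim: N S j => // N IH S j; rewrite ltnS => S_le.
set S1 := [set i in S | meets Phi i j]; set S2 := S :\: S1.
have S2_disj i : i \in S2 -> ~~ meets Phi i j.
  by rewrite !inE => /andP[+ iS]; rewrite iS.
have US : S1 :|: S2 = S.
  by rewrite /S2 setDE setUIr setUCr setIT; apply/setUidPr/subsetP=> i; rewrite inE => /andP[].
have le_viol : (2 ^ u * #|violating Phi a S j| <= #|sat_on Phi a S2|)%N.
  apply: leq_trans (violating_disjoint S2_disj); apply: leq_mul.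
    by rewrite leq_exp2l.
  apply/subset_leq_card/subsetP=> s; rewrite [in X in X -> _]inE => /andP[sS Vs]; rewrite inE Vs andbT.
  by move: sS; apply/subsetP/sat_onS/subsetDl.
have [S10|/set0Pn[i0 i0S1]] := eqVneq S1 set0.
  by move: le_viol; rewrite /S2 S10 setD0; lia.
have S2_lt : (#|S2| < N)%N.
  apply: leq_trans S_le; apply/proper_card/properP; split; first exact: subsetDl.
  by exists i0; [move: i0S1; rewrite inE => /andP[] | rewrite inE i0S1].
have := sat_on_union_bound S1 S2; rewrite US => ub.
have S1_le : (#|S1| <= D)%N.
  apply: leq_trans (degree_le j); apply/subset_leq_card/subsetP=> i.
  by rewrite !inE => /andP[].
have : (2 ^ u * \sum_(i in S1) #|violating Phi a S2 i|
        <= D * (2 * #|sat_on Phi a S2|))%N.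
  rewrite big_distrr /=; apply: (@leq_trans (\sum_(i in S1) 2 * #|sat_on Phi a S2|)).
    by apply: leq_sum => i _; apply: IH.
  by rewrite sum_nat_const leq_mul2r S1_le orbT.
move: ub le_viol D_le (expn_gt0 2 u).
set N2 := #|sat_on _ _ _|; set N1 := #|sat_on _ _ _|.
set V := #|_|; set X := (\sum_(_ in _) _)%N; set E := (2 ^ u)%N.
move=> h1 h2 h3 h4 h5.
have : (E * N2 <= E * N1 + D * (2 * N2))%N by nia.
nia.
Qed.

(** Clauses are imposed one at a time; each is violated by at most a fraction [2 / 2 ^ u < 1] of the
    assignments left, so some survive. *)
Lemma sat_on_gt0 (S : {set 'I_m}) : (2 < 2 ^ u)%N -> (0 < #|sat_on Phi a S|)%N.
Proof.
move=> u_gt; have [N] := ubnP #|S|; elim: N S => // N IH S; rewrite ltnS => S_le.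
have [->|/set0Pn[j jS]] := eqVneq S set0.
  apply/card_gt0P; exists [ffun v => odflt true (a v)]; rewrite inE.
  apply/andP; split; last by apply/forall_inP=> j; rewrite inE.
  by apply/forallP=> v; rewrite ffunE; case: (a v) => [b|]; rewrite ?eqxx ?orbT.
have := IH (S :\ j); rewrite (leq_trans _ S_le) => [/(_ isT)|]; last first.
  by rewrite [leqRHS](cardsD1 j) jS.
have := sat_on_union_bound [set j] (S :\ j); rewrite setD1K // big_set1.
have := local_lemma (S :\ j) j; nia.
Qed.

(** Without the clauses containing [y], the value of [y] is exactly uniform. The local lemma bounds
    how many assignments are gained by dropping those at most [d] clauses. *)
Lemma marginal_bound (d : nat) (y : 'I_n) (b : bool) :
  (#|[set j | y \in vars (Phi j)]| <= d)%N -> (4 * d <= 2 ^ u)%N ->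
  y \in unset a ->
  (2 ^ u * (2 * #|[set s in solutions Phi a | s y == b]|) <=
     (2 ^ u + 4 * d) * #|solutions Phi a|)%N.
Proof.
rewrite solutionsE => d_ge d_le ya; set S1 := [set j | _] in d_ge.
set X := #|[set s in _ | _]|.
have X_le : (2 * X <= #|sat_on Phi a (~: S1)|)%N.
  rewrite -(@card_flip _ (sat_on Phi a (~: S1)) y b).
    rewrite leq_mul2l /=; apply/subset_leq_card/subsetP=> s; rewrite [in X in X -> _]inE.
    move=> /andP[sT sb]; rewrite inE sb andbT; move: sT; apply/subsetP/sat_onS/subsetT.
  by move=> s; apply: sat_on_flip => // j; rewrite !inE.
have := sat_on_union_bound S1 (~: S1); rewrite setUCr => ub.
have : (2 ^ u * \sum_(i in S1) #|violating Phi a (~: S1) i|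
        <= d * (2 * #|sat_on Phi a (~: S1)|))%N.
  rewrite big_distrr /=.
  apply: (@leq_trans (\sum_(i in S1) 2 * #|sat_on Phi a (~: S1)|)).
    by apply: leq_sum => i _; apply: local_lemma.
  by rewrite sum_nat_const leq_mul2r d_ge orbT.
move: ub X_le d_le (expn_gt0 2 u).
set N2 := #|sat_on _ _ _|; set N1 := #|sat_on _ _ _|.
set Y := (\sum_(_ in _) _)%N; set E := (2 ^ u)%N.
move=> h1 h2 h3 h4 h5.
have h6 : (E * N2 <= E * N1 + d * (2 * N2))%N by nia.
(* Dropping the clauses at most doubles the count, which turns the error [2 * d * N2] into
   [4 * d * N1]. *)
have : (N2 <= 2 * N1)%N by nia.
nia.
Qed.

End LocalLemma.

(** * Marginals of unset variables are nearly uniform *)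

Lemma card_bigcup_le (I T : finType) (A : {set I}) (F : I -> {set T}) (K : nat) :
  (forall i, i \in A -> #|F i| <= K)%N ->
  (#|\bigcup_(i in A) F i| <= #|A| * K)%N.
Proof.
move=> F_le; apply: (@leq_trans (\sum_(i in A) #|F i|)).
  elim/big_rec2: _ => [|i k C _ le_C]; first by rewrite cards0.
  by rewrite (leq_trans (leq_card_setU _ _)) // leq_add2l.
by rewrite -sum_nat_const; apply: leq_sum.
Qed.

Lemma card_vars_setI_le (n m B d : nat) (Phi : cnf n m) (W : {set 'I_n}) :
  (#|W| <= B)%N ->
  (forall v, (#|[set j | v \in vars (Phi j)]| <= d)%N) ->
  (#|[set i | ~~ [disjoint vars (Phi i) & W]]| <= B * d)%N.
Proof.
move=> W_le deg.
apply: (@leq_trans #|\bigcup_(v in W) [set j | v \in vars (Phi j)]|).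
  apply/subset_leq_card/subsetP=> i; rewrite inE => /pred0Pn[v /andP[vi vW]].
  by apply/bigcupP; exists v => //; rewrite inE.
apply: leq_trans (card_bigcup_le (fun v _ => deg v)) _.
by rewrite leq_mul2r W_le orbT.
Qed.

(** The upper bound on the probability of false is the lower bound on that of true, so
    [marginal_bound] is applied to both values. *)
Lemma prob_true_near_half (R : realType) (n m u B d : nat) (Phi : cnf n m)
    (x : 'I_n) (marked : {set 'I_n}) (a : passignment n) (y : 'I_n) :
  (forall j, (u < #|vars (Phi j) :\: marked|)%N) ->
  (forall j, (#|vars (Phi j)| <= B)%N) ->
  (forall v, (#|[set j | v \in vars (Phi j)]| <= d)%N) ->
  (0 < B)%N -> (0 < d)%N -> (4 * (B * d) <= 2 ^ u)%N ->
  ~: unset a \subset x |: marked -> y \in unset a ->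
  `|prob_true R Phi a y - 1 / 2| <= (2 * d)%:R / (2 ^ u)%:R.
Proof.
move=> unm size_le deg B_gt0 d_gt0 u_ge dom_a ya.
(* The variable [x] may be unmarked and is set nevertheless: this costs one variable per clause,
   whence the strict inequality assumed on unmarked variables. *)
have uns j : (u <= #|vars (Phi j) :&: unset a|)%N.
  rewrite -ltnS; apply: leq_trans (unm j) _.
  apply: (@leq_trans #|x |: (vars (Phi j) :&: unset a)|); last first.
    by rewrite cardsU1; case: (_ \notin _).
  apply/subset_leq_card/subsetP=> v; rewrite !inE => /andP[nvm vj].
  rewrite vj; case: eqVneq => //= nvx; apply: contraT => va.
  by have := subsetP dom_a v; rewrite !inE va (negbTE nvx) (negbTE nvm) => /(_ isT).
have degD j : (#|[set i | meets Phi i j]| <= B * d)%N by exact: card_vars_setI_le.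
have d_le : (4 * d <= 2 ^ u)%N.
  by apply: leq_trans u_ge; rewrite leq_mul2l leq_pmull.
have E_gt2 : (2 < 2 ^ u)%N by lia.
have := marginal_bound uns degD u_ge true (deg y) d_le ya.
have := marginal_bound uns degD u_ge false (deg y) d_le ya.
have := sat_on_gt0 uns degD u_ge setT E_gt2; rewrite -solutionsE.
have : #|solutions Phi a| = (#|[set s in solutions Phi a | s y == true]|
                            + #|[set s in solutions Phi a | s y == false]|)%N.
  rewrite -(cardsID [set s : assignment n | s y]); congr (_ + _)%N.
    by apply: eq_card => s; rewrite !inE eqb_id.
  by apply: eq_card => s; rewrite !inE andbC eqbF_neg.
rewrite /prob_true.
have -> : [set s in solutions Phi a | s y] = [set s in solutions Phi a | s y == true].
  by apply/setP=> s; rewrite !inE eqb_id.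
set T := #|[set s in _ | _ == true]|; set F := #|[set s in _ | _]|.
set N := #|_|; set E := (2 ^ u)%N => NE N_gt0 hF hT.
have E0 : 0 < E%:R :> R by rewrite ltr0n; lia.
have N0 : 0 < N%:R :> R by rewrite ltr0n.
have hT' : E%:R * (2 * T%:R) <= (E%:R + 4 * d%:R) * N%:R :> R.
  by rewrite -!natrM -natrD -natrM ler_nat.
have hF' : E%:R * (2 * F%:R) <= (E%:R + 4 * d%:R) * N%:R :> R.
  by rewrite -!natrM -natrD -natrM ler_nat.
have NE' : N%:R = T%:R + F%:R :> R by rewrite NE natrD.
have le_div (X : R) : E%:R * (2 * X) <= (E%:R + 4 * d%:R) * N%:R ->
    X / N%:R <= 1 / 2 + (2 * d)%:R / E%:R.
  move=> hX; rewrite ler_pdivrMr // -(@ler_pM2l _ (2 * E%:R)) ?mulr_gt0 //.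
  rewrite natrM.
  have -> : 2 * E%:R * ((1 / 2 + 2%:R * d%:R / E%:R) * N%:R)
            = (E%:R + 4 * d%:R) * N%:R :> R by field; rewrite gt_eqF.
  by rewrite mulrAC mulrC.
have := le_div _ hT'; have := le_div _ hF'.
have -> : F%:R / N%:R = 1 - T%:R / N%:R :> R.
  have -> : F%:R = N%:R - T%:R :> R by rewrite NE'; ring.
  by rewrite mulrBl divff ?gt_eqF.
move=> h1 h2; rewrite ler_norml; lra.
Qed.

(** * Expectations and the coupling of one variable *)

Definition Ex (R : realType) (T : finType) (mu : {ffun T -> R}) (f : T -> R) : R :=
  \sum_x mu x * f x.

Lemma Ex_dirac (R : realType) (T : finType) (z : T) (f : T -> R) :
  Ex (dirac R z) f = f z.
Proof.
rewrite /Ex (bigD1 z) //= ffunE eqxx mul1r big1 ?addr0 // => y /negbTE nyz.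
by rewrite ffunE nyz mul0r.
Qed.

Lemma Ex_bind (R : realType) (T U : finType) (mu : {ffun T -> R})
    (g : T -> {ffun U -> R}) (f : U -> R) :
  Ex (bind mu g) f = Ex mu (fun z => Ex (g z) f).
Proof.
rewrite /Ex; under eq_bigr => u _ do rewrite ffunE mulr_suml.
rewrite exchange_big /=; apply: eq_bigr => z _; rewrite mulr_sumr.
by apply: eq_bigr => u _; rewrite mulrA.
Qed.

Lemma ler_Ex (R : realType) (T : finType) (mu : {ffun T -> R}) (f g : T -> R) :
  (forall z, 0 <= mu z) -> (forall z, mu z != 0 -> f z <= g z) ->
  Ex mu f <= Ex mu g.
Proof.
move=> mu0 fg; apply: ler_sum => z _; have [->|mz] := eqVneq (mu z) 0.
  by rewrite !mul0r.
by rewrite ler_wpM2l ?fg.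
Qed.

Lemma Ex_add (R : realType) (T : finType) (mu : {ffun T -> R}) (f g : T -> R) :
  Ex mu (fun z => f z + g z) = Ex mu f + Ex mu g.
Proof. by rewrite /Ex -big_split; apply: eq_bigr => z _; rewrite mulrDr. Qed.

Lemma Ex_scale (R : realType) (T : finType) (mu : {ffun T -> R}) (c : R)
    (f : T -> R) :
  Ex mu (fun z => c * f z) = c * Ex mu f.
Proof. by rewrite /Ex mulr_sumr; apply: eq_bigr => z _; rewrite mulrCA. Qed.

Section CoupleVar.
Context (R : realType) (n m : nat) (Phi : cnf n m).
Implicit Types (a : passignment n * passignment n) (y : 'I_n).
Local Notation pr := (prob_true R Phi).

Lemma prob_true_ge0 (b : passignment n) y : 0 <= pr b y.
Proof. by rewrite divr_ge0. Qed.

Lemma prob_true_le1 (b : passignment n) y : pr b y <= 1.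
Proof.
rewrite /prob_true; have [->|N_gt0] := posnP #|solutions Phi b|.
  by rewrite invr0 mulr0.
rewrite ler_pdivrMr ?ltr0n // mul1r ler_nat subset_leq_card //.
by apply/subsetP=> s; rewrite inE => /andP[].
Qed.

(** Once the minima are resolved, the disagreeing outcome has weight equal to the distance between
    the two marginals. *)
Lemma Ex_couple_var y a (f : passignment n * passignment n -> R) :
  Ex (couple_var R Phi y a) f =
    if pr a.2 y < pr a.1 y then
      pr a.2 y * f (pset2 a y true true)
      + (1 - pr a.1 y) * f (pset2 a y false false)
      + (pr a.1 y - pr a.2 y) * f (pset2 a y true false)
    else
      pr a.1 y * f (pset2 a y true true)
      + (1 - pr a.2 y) * f (pset2 a y false false)
      + (pr a.2 y - pr a.1 y) * f (pset2 a y false true).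
Proof.
rewrite /Ex /couple_var.
under eq_bigr => z _ do rewrite ffunE !mulrDl -!mulrA.
rewrite !big_split /= -!mulr_sumr.
rewrite -!/(Ex _ f) !Ex_dirac.
case: ltP => h.
  rewrite (min_idPl (_ : 1 - pr a.1 y <= 1 - pr a.2 y)); last by lra.
  by ring.
rewrite (min_idPr (_ : 1 - pr a.2 y <= 1 - pr a.1 y)); last by lra.
by ring.
Qed.

(** The coupling property: each side, taken alone, follows its own conditional law. *)
Lemma Ex_couple_var1 y a (f : passignment n -> R) :
  Ex (couple_var R Phi y a) (fun a' => f a'.1) =
    pr a.1 y * f (pset a.1 y true) + (1 - pr a.1 y) * f (pset a.1 y false).
Proof. by rewrite Ex_couple_var /=; case: ifP => _; ring. Qed.

Lemma Ex_couple_var2 y a (f : passignment n -> R) :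
  Ex (couple_var R Phi y a) (fun a' => f a'.2) =
    pr a.2 y * f (pset a.2 y true) + (1 - pr a.2 y) * f (pset a.2 y false).
Proof. by rewrite Ex_couple_var /=; case: ifP => _; ring. Qed.

Lemma couple_varE y a a' :
  couple_var R Phi y a a' = Ex (couple_var R Phi y a) (fun z => (z == a')%:R).
Proof.
rewrite /Ex (bigD1 a') //= eqxx mulr1 big1 ?addr0 // => z /negbTE ->.
by rewrite mulr0.
Qed.

Lemma couple_var_ge0 y a a' : 0 <= couple_var R Phi y a a'.
Proof.
rewrite couple_varE Ex_couple_var.
have := (prob_true_ge0 a.1 y, prob_true_ge0 a.2 y).
have := (prob_true_le1 a.1 y, prob_true_le1 a.2 y).
move=> [h1 h2] [h3 h4].
case: ltP => [/ltW|] h; apply: addr_ge0; try apply: addr_ge0;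
  by rewrite mulr_ge0 ?subr_ge0.
Qed.

Lemma couple_var_supp y a a' :
  couple_var R Phi y a a' != 0 -> exists b1 b2, a' = pset2 a y b1 b2.
Proof.
have [/existsP[b1 /existsP[b2 /eqP ->]] _|] :=
  boolP [exists b1, exists b2, a' == pset2 a y b1 b2]; first by exists b1, b2.
move=> /existsPn no; rewrite couple_varE Ex_couple_var.
have no' b1 b2 : (pset2 a y b1 b2 == a') = false.
  by have /existsPn/(_ b2)/negbTE := no b1; rewrite eq_sym.
by rewrite !no' !mulr0 !addr0 if_same eqxx.
Qed.

End CoupleVar.

Section CoupleVars.
Context (R : realType) (n m : nat) (Phi : cnf n m).

Lemma couple_vars_ge0 ys a a' : 0 <= couple_vars R Phi ys a a'.
Proof.
elim: ys a => [|y ys IH] a /=; first by rewrite ffunE.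
by rewrite ffunE sumr_ge0 // => z _; rewrite mulr_ge0 ?couple_var_ge0.
Qed.

Lemma couple_vars_supp ys a a' : couple_vars R Phi ys a a' != 0 ->
  forall v, if v \in ys then a'.1 v != None /\ a'.2 v != None
            else a'.1 v = a.1 v /\ a'.2 v = a.2 v.
Proof.
elim: ys a => [|y ys IH] a /=.
  by rewrite ffunE; have [->|] := eqVneq a' a; rewrite ?eqxx.
rewrite ffunE => nz v.
have [z] : exists z, couple_var R Phi y a z * couple_vars R Phi ys z a' != 0.
  apply/existsP; apply: contraR nz => /existsPn all0; apply/eqP/big1 => z _.
  by have /negbNE/eqP := all0 z.
rewrite mulf_eq0 negb_or => /andP[/couple_var_supp[b1 [b2 ->]] /IH/(_ v)].
rewrite inE; case: (v \in ys); first by rewrite orbT.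
by rewrite orbF !ffunE; case: eqP => // _ [-> ->].
Qed.

End CoupleVars.

(** * The potential of a clause *)

(** The variable [x] is excluded because the two assignments differ there from the start. *)
Definition disagrees (n : nat) (x : 'I_n) (c : clause n)
    (a : passignment n * passignment n) : bool :=
  [exists v in vars c, (v != x) && (a.1 v != a.2 v)].

Definition pending (n : nat) (marked : {set 'I_n}) (c : clause n)
    (a : passignment n * passignment n) : {set 'I_n} :=
  vars c :&: marked :&: unset a.1.

(* Union bound for the conditional probability that c becomes bad: each pending
   variable disagrees with probability at most 2e, and misses its literal with
   probability at most 1/2 + e. *)
Definition potential (R : realType) (n : nat) (x : 'I_n) (marked : {set 'I_n})
    (e : R) (c : clause n) (a : passignment n * passignment n) : R :=
  (disagrees x c a)%:R + 2 * e * #|pending marked c a|%:R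
  + (1 / 2 + e) ^+ #|pending marked c a|
    * ((~~ psat c a.1)%:R + (~~ psat c a.2)%:R).

(** The shape of every pair met by the run. The last condition keeps all unmarked variables other
    than [x] unset, as the local lemma requires. *)
Definition admissible (n : nat) (x : 'I_n) (marked : {set 'I_n})
    (a : passignment n * passignment n) : Prop :=
  [/\ unset a.1 = unset a.2, x \notin unset a.1
    & ~: unset a.1 \subset x |: marked].

Section Potential.
Context (R : realType) (n m : nat) (Phi : cnf n m) (x : 'I_n).
Context (marked : {set 'I_n}) (e : R).
Hypothesis e_ge0 : 0 <= e.
Hypothesis near_half : forall (a : passignment n) y,
  ~: unset a \subset x |: marked -> y \in unset a ->
  `|prob_true R Phi a y - 1 / 2| <= e.
Implicit Types (a : passignment n * passignment n) (y : 'I_n) (c : clause n).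
Local Notation pot := (potential x marked e).

Lemma potential_ge0 c a : 0 <= pot c a.
Proof.
apply: addr_ge0; first by rewrite addr_ge0 ?mulr_ge0.
by rewrite mulr_ge0 ?exprn_ge0 ?addr_ge0 ?divr_ge0.
Qed.

Lemma unset_pset (b : passignment n) y v : unset (pset b y v) = unset b :\ y.
Proof. by apply/setP=> w; rewrite !inE ffunE; case: (w =P y). Qed.

Lemma psat_pset_notin c (b : passignment n) y v :
  y \notin vars c -> psat c (pset b y v) = psat c b.
Proof.
move=> nyc; apply: eq_existsb => l; case lc: (l \in c) => //=.
rewrite ffunE ifN //; apply: contra nyc => /eqP <-; exact: imset_f.
Qed.

Lemma potential_pset2_notin c a y b1 b2 :
  y \notin vars c -> pot c (pset2 a y b1 b2) = pot c a.
Proof.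
move=> nyc; rewrite /potential /= !psat_pset_notin //.
have -> : pending marked c (pset2 a y b1 b2) = pending marked c a.
  rewrite /pending /= unset_pset setIDA; apply/setDidPl.
  by rewrite disjoint_sym disjoints1 !inE (negbTE nyc).
congr ((_ : bool)%:R + _ + _); apply: eq_existsb => v; case vc: (v \in vars c) => //=.
have /negbTE nvy : v != y by apply: contra nyc => /eqP <-.
by rewrite !ffunE nvy.
Qed.

Lemma psatN_pset c (b : passignment n) y v :
  y \in unset b ->
  ((~~ psat c (pset b y v))%:R : R) <= ((y, v) \notin c)%:R * (~~ psat c b)%:R.
Proof.
rewrite inE => /eqP by0; rewrite -natrM mulnb ler_nat.
case: (boolP (psat c (pset b y v))) => //= /existsPn np.
have -> : (y, v) \notin c by have := np (y, v); rewrite /= ffunE eqxx eqxx andbT.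
rewrite lt0b; apply/existsPn=> l; apply: contra (np l) => /andP[-> /eqP bl].
rewrite ffunE; case: (l.1 =P y) => [ly|_]; last by rewrite bl eqxx.
by move: bl; rewrite ly by0.
Qed.

(** At least one literal of [y] lies in [c]; the clause can stay unsatisfied only if [y] takes the
    opposite value, which has probability at most [1 / 2 + e]. *)
Lemma Ex_psatN c (b : passignment n) y :
  ~: unset b \subset x |: marked -> y \in unset b -> y \in vars c ->
  prob_true R Phi b y * (~~ psat c (pset b y true))%:R
  + (1 - prob_true R Phi b y) * (~~ psat c (pset b y false))%:R
  <= (1 / 2 + e) * (~~ psat c b)%:R.
Proof.
move=> dom_b yb yc; have := near_half dom_b yb.
have := psatN_pset c true yb; have := psatN_pset c false yb.
have := prob_true_ge0 R Phi b y; have := prob_true_le1 R Phi b y.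
move: (prob_true _ _ _ _) => p p1 p0; rewrite ler_norml => hF hT /andP[h1 h2].
set N := (~~ psat c b)%:R in hF hT *; have N0 : 0 <= N :> R by [].
have : ((y, true) \in c) || ((y, false) \in c).
  by case/imsetP: yc => -[w [] lc ->]; rewrite lc ?orbT.
case/orP => lc; [move: hT | move: hF]; rewrite lc mul0r => h0.
  apply: (@le_trans _ _ ((1 - p) * N)).
    rewrite -[leRHS]add0r lerD //; first by rewrite mulr_ge0_le0.
    rewrite ler_wpM2l ?subr_ge0 // (le_trans hF) // ler_piMl //.
    by case: (_ \notin _).
  by rewrite ler_wpM2r //; lra.
apply: (@le_trans _ _ (p * N)).
  rewrite -[leRHS]addr0 lerD //; last by rewrite mulr_ge0_le0 // subr_ge0.
  by rewrite ler_wpM2l // (le_trans hT) // ler_piMl //; case: (_ \notin _).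
by rewrite ler_wpM2r //; lra.
Qed.

(** Both marginals are within [e] of [1 / 2], so the two values of [y] differ with probability at
    most [2 * e]. *)
Lemma Ex_disagrees c a y :
  admissible x marked a -> y \in unset a.1 ->
  Ex (couple_var R Phi y a) (fun a' => (disagrees x c a')%:R)
  <= (disagrees x c a)%:R + 2 * e.
Proof.
move=> [eq_u _ dom_a] ya; have := near_half dom_a ya.
have ya2 : y \in unset a.2 by rewrite -eq_u.
have dom_a2 : ~: unset a.2 \subset x |: marked by rewrite -eq_u.
have := near_half dom_a2 ya2; rewrite Ex_couple_var.
have same b : disagrees x c (pset2 a y b b) = disagrees x c a.
  apply: eq_existsb => v; rewrite !ffunE; case: (v =P y) => // ->.
  by move: ya ya2; rewrite !inE => /eqP -> /eqP ->; rewrite !eqxx.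
rewrite !same; set D := (disagrees x c a)%:R.
have D0 : 0 <= D :> R by [].
move: (prob_true _ _ _ _) (prob_true _ _ _ _) => p1 p2.
rewrite !ler_norml => /andP[h1 h2] /andP[h3 h4].
have le1 (b : bool) : b%:R <= 1 + D.
  by apply: (@le_trans _ _ 1); [case: b | rewrite lerDl].
case: (ltP p2 p1) => h.
  apply: (@le_trans _ _ (p2 * D + (1 - p1) * D + (p1 - p2) * (1 + D))); last by lra.
  by rewrite lerD2l ler_wpM2l // subr_ge0 ltW.
apply: (@le_trans _ _ (p1 * D + (1 - p2) * D + (p2 - p1) * (1 + D))); last by lra.
by rewrite lerD2l ler_wpM2l // subr_ge0.
Qed.

Lemma Ex_couple_var_cst y a (K : R) : Ex (couple_var R Phi y a) (fun=> K) = K.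
Proof. by rewrite Ex_couple_var; case: ifP => _; ring. Qed.

(** Setting [y] removes it from the pending variables: the term [2 * e] thus released pays for a new
    disagreement, and the released factor [1 / 2 + e] for the chance that [c] stays unsatisfied. *)
Lemma Ex_potential c a y :
  admissible x marked a -> y \in unset a.1 -> y \in marked -> y \in vars c ->
  Ex (couple_var R Phi y a) (pot c) <= pot c a.
Proof.
move=> adm ya ym yc; have [eq_u _ dom_a] := adm.
have ya2 : y \in unset a.2 by rewrite -eq_u.
have dom_a2 : ~: unset a.2 \subset x |: marked by rewrite -eq_u.
set r := #|pending marked c a :\ y|.
have r_a : #|pending marked c a| = r.+1.
  by rewrite (cardsD1 y) !inE yc ym; move: ya; rewrite inE => ->.
pose q := 1 / 2 + e; have q_ge0 : 0 <= q by rewrite addr_ge0 ?divr_ge0.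
apply: (@le_trans _ _ (Ex (couple_var R Phi y a) (fun a' => (disagrees x c a')%:R)
   + 2 * e * r%:R
   + q ^+ r * (Ex (couple_var R Phi y a) (fun a' => (~~ psat c a'.1)%:R)
               + Ex (couple_var R Phi y a) (fun a' => (~~ psat c a'.2)%:R)))).
  rewrite -Ex_add -Ex_scale -[X in _ + X + _](Ex_couple_var_cst y a) -!Ex_add.
  apply: ler_Ex => [z|z /couple_var_supp[b1 [b2 ->]]]; first exact: couple_var_ge0.
  by rewrite /potential /pending /= unset_pset setIDA.
rewrite (Ex_couple_var1 Phi y a (fun b => (~~ psat c b)%:R)).
rewrite (Ex_couple_var2 Phi y a (fun b => (~~ psat c b)%:R)).
rewrite /potential r_a -/q; apply: lerD.
  rewrite -[r.+1%:R]natr1 [2 * e * (_ + 1)]mulrDr mulr1 [_ + 2 * e]addrC addrA lerD2r.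
  exact: Ex_disagrees.
rewrite exprSr -mulrA ler_wpM2l ?exprn_ge0 // mulrDr.
by apply: lerD; apply: Ex_psatN.
Qed.

Definition potential_prod (T : seq 'I_m) a : R := \prod_(j <- T) pot (Phi j) a.

Lemma potential_prod_ge0 T a : 0 <= potential_prod T a.
Proof. by rewrite prodr_ge0 // => j _; apply: potential_ge0. Qed.

(* A variable lies in at most one clause of T, so only one factor moves. *)
Lemma Ex_potential_prod T a y :
  pairwise (fun i j => ~~ meets Phi i j) T ->
  admissible x marked a -> y \in unset a.1 -> y \in marked ->
  Ex (couple_var R Phi y a) (potential_prod T) <= potential_prod T a.
Proof.
rewrite /potential_prod => + adm ya ym; elim: T => [|j T IH] /=.
  move=> _; rewrite big_nil -[leRHS](Ex_couple_var_cst y a).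
  by apply: ler_Ex => [z|z _]; [exact: couple_var_ge0 | rewrite big_nil].
move=> /andP[/allP disj pw]; rewrite big_cons.
have [yj|nyj] := boolP (y \in vars (Phi j)).
  apply: (@le_trans _ _ (Ex (couple_var R Phi y a)
      (fun a' => (\prod_(i <- T) pot (Phi i) a) * pot (Phi j) a'))).
    apply: ler_Ex => [z|z /couple_var_supp[b1 [b2 ->]]]; first exact: couple_var_ge0.
    rewrite big_cons mulrC.
    rewrite le_eqVlt; apply/orP; left; apply/eqP; congr (_ * _).
    apply: eq_big_seq => i /disj.
    rewrite negbK => dij; apply: potential_pset2_notin.
    by rewrite (disjointFr dij yj).
  rewrite Ex_scale mulrC ler_wpM2r ?Ex_potential //.
  exact: potential_prod_ge0.
apply: (@le_trans _ _ (Ex (couple_var R Phi y a)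
    (fun a' => pot (Phi j) a * \prod_(i <- T) pot (Phi i) a'))).
  apply: ler_Ex => [z|z /couple_var_supp[b1 [b2 ->]]]; first exact: couple_var_ge0.
  by rewrite big_cons potential_pset2_notin.
by rewrite Ex_scale ler_wpM2l ?IH ?potential_ge0.
Qed.

Lemma admissible_pset2 a y b1 b2 :
  admissible x marked a -> y \in marked -> admissible x marked (pset2 a y b1 b2).
Proof.
move=> [eq_u x_set dom_a] ym; split => /=; rewrite ?unset_pset ?eq_u //.
  by rewrite -eq_u in_setD (negbTE x_set) andbF.
by rewrite -eq_u setCD subUset dom_a sub1set in_setU ym orbT.
Qed.

Lemma Ex_couple_vars_potential_prod T ys a :
  pairwise (fun i j => ~~ meets Phi i j) T -> admissible x marked a ->
  uniq ys -> {subset ys <= unset a.1} -> {subset ys <= marked} ->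
  Ex (couple_vars R Phi ys a) (potential_prod T) <= potential_prod T a.
Proof.
move=> pw; elim: ys a => [|y ys IH] a adm /=; first by rewrite Ex_dirac.
move=> /andP[nyys uys] ys_u ys_m; rewrite Ex_bind.
have [ya ym] : y \in unset a.1 /\ y \in marked.
  by split; [apply: ys_u | apply: ys_m]; apply: mem_head.
apply: le_trans (Ex_potential_prod pw adm ya ym).
apply: ler_Ex => [z|z /couple_var_supp[b1 [b2 ->]]]; first exact: couple_var_ge0.
apply: IH => //; first exact: admissible_pset2.
  move=> v vys; rewrite /= unset_pset in_setD1 ys_u ?inE ?vys ?orbT // andbT.
  by apply: contra nyys => /eqP <-.
by move=> v vys; apply: ys_m; rewrite inE vys orbT.
Qed.

End Potential.

(** * Witness trees and walks *)

Definition near (n m : nat) (Phi : cnf n m) (i j : 'I_m) : bool :=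
  [exists c, meets Phi i c && meets Phi c j].

(* The most recent clause comes first. *)
Fixpoint witness (n m : nat) (Phi : cnf n m) (x : 'I_n) (T : seq 'I_m) : bool :=
  if T is j :: T' then
    [&& if nilp T' then x \in vars (Phi j) else has (fun i => near Phi i j) T',
        all (fun i => ~~ meets Phi j i) T' & witness Phi x T']
  else true.

(** The starting clause is not recorded, so each list has length [l]. *)
Fixpoint walks (n m : nat) (Phi : cnf n m) (l : nat) (j : 'I_m) :
    seq (seq 'I_m) :=
  if l is l'.+1 then
    [seq i :: w | i <- enum [set i | near Phi j i], w <- walks Phi l' i]
  else [:: [::]].

Lemma perm_pairwise (I : eqType) (r : rel I) (s1 s2 : seq I) :
  symmetric r -> perm_eq s1 s2 -> pairwise r s1 -> pairwise r s2.
Proof.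
move=> sym_r; move: s1 s2; apply: catCA_perm_ind => s1 s2 s3.
rewrite !pairwise_cat !allrel_catr => /and3P[/andP[r12 r13] p1 /and3P[r23 p2 p3]].
by rewrite allrelC r13 r23 p1 p2 p3 !andbT (eq_allrel (r' := r)).
Qed.

Section Witness.
Context (n m : nat) (Phi : cnf n m) (x : 'I_n).
Implicit Types (T w : seq 'I_m).

Lemma meets_sym i j : meets Phi i j = meets Phi j i.
Proof. by rewrite /meets disjoint_sym. Qed.

Lemma near_sym i j : near Phi i j = near Phi j i.
Proof. by apply: eq_existsb => c; rewrite andbC ![meets _ c _]meets_sym. Qed.

Lemma common_var_meets v i j :
  v \in vars (Phi i) -> v \in vars (Phi j) -> meets Phi i j.
Proof. by move=> vi vj; apply/pred0Pn; exists v; rewrite /= vi. Qed.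

(** The most recent clauses stand in front, so dropping them returns to an earlier stage of the
    construction. *)
Lemma witness_drop T k : witness Phi x T -> witness Phi x (drop k T).
Proof.
by elim: T k => [|j T IH] [|k] //= /and3P[_ _ wT]; apply: IH.
Qed.

Lemma witness_pairwise T :
  witness Phi x T -> pairwise (fun i j => ~~ meets Phi i j) T.
Proof. by elim: T => //= j T IH /and3P[_ -> /IH]. Qed.

Lemma witness_root T :
  witness Phi x T -> ~~ nilp T -> exists2 t, t \in T & x \in vars (Phi t).
Proof.
elim: T => //= j [_|i T IH] /and3P[xj _ wT] _.
  by exists j; rewrite ?mem_head.
by have [//|t tT xt] := IH wT; exists t => //; rewrite inE tT orbT.
Qed.

(* Each new clause is reached by a detour of two steps from a clause already
   visited. *)
Lemma witness_walk T :
  witness Phi x T -> ~~ nilp T ->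
  exists j w, [/\ x \in vars (Phi j), path (near Phi) j w,
                  size w = (2 * (size T).-1)%N & j :: w =i T].
Proof.
elim: T => //= j T IH /and3P[+ _ wT] _.
case: ifP => [/nilP -> xj|/negbT nT /hasP[i iT ij]].
  by exists j, [::].
have [j0 [w0 [xj0 + + memT]]] := IH wT nT.
move: iT; rewrite -memT => iw.
case/splitPl: {w0}_ / iw memT => p1 p2 last_p1 memT.
rewrite cat_path last_p1 => /andP[path1 path2] sz.
exists j0, (p1 ++ j :: i :: p2); split => //.
- by rewrite cat_path /= last_p1 path1 ij near_sym ij.
- by move: sz nT; rewrite !size_cat /nilp /=; case: (size T) => //= r; lia.
- move=> z; rewrite !inE -memT !inE !mem_cat !inE -last_p1.
  have := mem_last j0 p1; rewrite inE.
  have [->|_] := eqVneq z (last j0 p1).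
    by move=> /orP[->|->]; rewrite ?orbT.
  by move=> _ /=; case: (z == j0); case: (z \in p1); case: (z == j); case: (z \in p2).
Qed.

Lemma mem_walks j w : path (near Phi) j w -> w \in walks Phi (size w) j.
Proof.
elim: w j => //= i w IH j /andP[ji pw]; apply/allpairsPdep.
by exists i, w; rewrite mem_enum inE ji IH.
Qed.

Lemma size_walks D l j :
  (forall i, (#|[set i' | near Phi i i']| <= D)%N) ->
  (size (walks Phi l j) <= D ^ l)%N.
Proof.
move=> deg; elim: l j => //= l IH j; rewrite size_allpairs_dep sumnE big_map.
apply: (@leq_trans (\sum_(i <- enum [set i | near Phi j i]) D ^ l)).
  by apply: leq_sum => i _; apply: IH.
by rewrite big_const_seq count_predT iter_addn_0 mulnC expnS leq_mul2r -cardE deg orbT.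
Qed.

Lemma card_near B d :
  (forall j, (#|vars (Phi j)| <= B)%N) ->
  (forall v, (#|[set j | v \in vars (Phi j)]| <= d)%N) ->
  forall j, (#|[set i | near Phi j i]| <= (B * d) ^ 2)%N.
Proof.
move=> size_le deg j.
have deg_meets i : (#|[set c | meets Phi c i]| <= B * d)%N by exact: card_vars_setI_le.
apply: (@leq_trans #|\bigcup_(c in [set c | meets Phi c j]) [set i | meets Phi i c]|).
  apply/subset_leq_card/subsetP=> i; rewrite inE => /existsP[c /andP[jc ci]].
  by apply/bigcupP; exists c; rewrite inE meets_sym.
apply: leq_trans (card_bigcup_le (fun c _ => deg_meets c)) _.
by rewrite leq_mul2r deg_meets orbT.
Qed.

End Witness.

(** * The run of the coupling *)

Section Run.
Context (R : realType) (n m : nat) (Phi : cnf n m) (x : 'I_n).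
Context (marked : {set 'I_n}).
Implicit Types (a : passignment n * passignment n) (j : 'I_m) (T : seq 'I_m).

Definition bad a j : bool :=
  disagrees x (Phi j) a
  || (pending marked (Phi j) a == set0)
     && ~~ (psat (Phi j) a.1 && psat (Phi j) a.2).

(** Either the indicator of disagreement is 1, or nothing is pending, the power is 1, and it
    multiplies the number of sides left unsatisfied. *)
Lemma bad_potential (e : R) a j :
  0 <= e -> bad a j -> 1 <= potential x marked e (Phi j) a.
Proof.
move=> e0; rewrite /bad /potential.
have q0 : 0 <= 1 / 2 + e by rewrite addr_ge0 ?divr_ge0.
case/orP => [-> | /andP[/eqP -> np]].
  by rewrite -addrA lerDl addr_ge0 ?mulr_ge0 ?exprn_ge0 ?addr_ge0 ?divr_ge0.
rewrite cards0 mulr0 addr0 expr0 mul1r -[leLHS]add0r lerD //.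
by move: np; case: (psat _ _); case: (psat _ _) => // _; rewrite ?add0r ?addr0 // lerDl.
Qed.

(** Values are never revised, so a disagreement stays. A clause with nothing pending receives no
    further value, so no side becomes satisfied later. *)
Lemma bad_persists a a' j :
  admissible x marked a -> admissible x marked a' ->
  (forall v, v \notin unset a.1 -> a'.1 v = a.1 v /\ a'.2 v = a.2 v) ->
  bad a j -> bad a' j.
Proof.
move=> [eq_u x_set dom_a] [eq_u' x_set' dom_a'] ext.
case/orP => [/existsP[v /and3P[vj vx ne]]|/andP[/eqP pend np]].
  apply/orP; left; apply/existsP; exists v; rewrite vj vx /=.
  have [|-> -> //] := ext v; apply: contra ne => va.
  have : v \in unset a.2 by rewrite -eq_u.
  by move: va; rewrite !inE => /eqP -> /eqP ->.
(* A variable set in [a'] is [x] or marked; in a clause with nothing pending it was therefore set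
   before. *)
have was_set v : v \in vars (Phi j) -> v \notin unset a'.1 -> v \notin unset a.1.
  move=> vj; rewrite -in_setC => /(subsetP dom_a'); rewrite in_setU1.
  case/orP => [/eqP -> //|vm]; apply/negP=> va.
  by have : v \in pending marked (Phi j) a; [rewrite !in_setI vj vm | rewrite pend inE].
have psat_back (b b' : passignment n) :
    unset b' = unset a'.1 -> (forall v, v \notin unset a.1 -> b' v = b v) ->
    psat (Phi j) b' -> psat (Phi j) b.
  move=> eq_b ext_b /existsP[l /andP[lj /eqP bl]]; apply/existsP; exists l.
  rewrite lj -ext_b ?bl ?eqxx // was_set //; first exact: imset_f.
  by rewrite -eq_b inE bl.
apply/orP; right; apply/andP; split.
  rewrite -subset0 -pend; apply: setIS; apply/subsetP=> v; apply: contraLR => va.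
  by have [e1 _] := ext v va; move: va; rewrite !inE e1.
apply: contra np => /andP[p1 p2]; apply/andP; split.
  by apply: psat_back p1 => // v /ext[].
by apply: psat_back p2 => // v /ext[].
Qed.

(** The variable [x] is added separately to account for the initial [V_I], when [T] is still
    empty. *)
Definition covered T : {set 'I_n} :=
  x |: \bigcup_(t in [set t in T]) \bigcup_(c in [set c | meets Phi c t]) vars (Phi c).

Lemma coveredP T v :
  reflect (v = x \/ exists t c, [/\ t \in T, meets Phi c t & v \in vars (Phi c)])
    (v \in covered T).
Proof.
rewrite in_setU1; apply: (iffP orP) => -[/eqP|h]; try by left.
- by right; case/bigcupP: h => t + /bigcupP[c]; rewrite !inE => tT ct vc; exists t, c.
- right; case: h => t [c [tT ct vc]]; apply/bigcupP; exists t; rewrite ?inE //.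
  by apply/bigcupP; exists c; rewrite ?inE.
Qed.

Lemma card_covered B d T :
  (forall j, (#|vars (Phi j)| <= B)%N) ->
  (forall v, (#|[set j | v \in vars (Phi j)]| <= d)%N) ->
  (#|covered T| <= 1 + size T * (B * d * B))%N.
Proof.
move=> size_le deg; rewrite cardsU1 leq_add ?leq_b1 //.
apply: (@leq_trans (#|[set t in T]| * (B * d * B))); last first.
  by rewrite leq_mul2r cardsE card_size orbT.
apply: card_bigcup_le => t _.
apply: (@leq_trans (#|[set c | meets Phi c t]| * B)).
  by apply: card_bigcup_le => c _.
by rewrite leq_mul2r (card_vars_setI_le (size_le t) deg) orbT.
Qed.

(** The greedy family [T] depends on the history, which a state does not record; hence the
    existential. *)
Definition run_inv (s : state n m) : Prop :=
  admissible x marked (asg s) /\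
  exists T, [/\ witness Phi x T, all (bad (asg s)) T & VI s \subset covered T].

Lemma init_inv : run_inv (init m x).
Proof.
split.
  have ui b : unset (pset [ffun=> None] x b) = ~: [set x].
    by apply/setP=> v; rewrite !inE !ffunE; case: (v =P x).
  by split; rewrite /= ?ui ?setCK ?sub1set ?inE ?eqxx.
by exists [::]; split=> //; rewrite sub1set in_setU1 eqxx.
Qed.

Context (next_clause : state n m -> option 'I_m).
Context (var_order : state n m -> 'I_m -> seq 'I_n).
Hypothesis clause_rule : valid_clause_rule Phi next_clause.
Hypothesis order_rule : valid_var_order Phi marked var_order.
Hypothesis vars_neq0 : forall j, vars (Phi j) != set0.
Local Notation step := (step R Phi next_clause var_order).

Lemma mem_var_order s j v :
  (v \in var_order s j) = (v \in pending marked (Phi j) (asg s)).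
Proof. by rewrite (perm_mem (order_rule s j)) mem_enum !inE andbA. Qed.

Lemma update_inv s j a :
  run_inv s -> j \in eligible Phi s ->
  couple_vars R Phi (var_order s j) (asg s) a != 0 ->
  run_inv (update Phi s j a).
Proof.
move=> [adm [T [wT badT cov]]] js /couple_vars_supp supp.
have [eq_u x_set dom_s] := adm.
have ext v : v \notin unset (asg s).1 -> a.1 v = (asg s).1 v /\ a.2 v = (asg s).2 v.
  move=> va; have := supp v; rewrite mem_var_order.
  by rewrite !in_setI (negbTE va) andbF.
have unset_a : unset a.1 = unset (asg s).1 :\: pending marked (Phi j) (asg s).
  apply/setP=> v; have := supp v; rewrite mem_var_order in_setD.
  by case: ifP => _ [h1 h2] /=; rewrite !inE ?(negbTE h1) // h1.
have unset_a2 : unset a.2 = unset (asg s).1 :\: pending marked (Phi j) (asg s).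
  rewrite eq_u; apply/setP=> v; have := supp v; rewrite mem_var_order in_setD.
  by case: ifP => _ [h1 h2] /=; rewrite !inE ?(negbTE h2) // h2.
have adm_a : admissible x marked a.
  split; rewrite ?unset_a ?unset_a2 //; first by rewrite in_setD (negbTE x_set) andbF.
  rewrite setCD subUset dom_s; apply/subsetP=> v.
  by rewrite !in_setI in_setU => /andP[/andP[_ ->] _]; rewrite orbT.
have pend_a : pending marked (Phi j) a = set0.
  apply/setP=> v; rewrite /pending unset_a [RHS]inE !in_setI in_setD !in_setI.
  by case: (v \in vars _); case: (v \in marked); case: (v \in unset _).
have badT_a : all (bad a) T by apply: sub_all badT => i; apply: bad_persists.
have asgE : asg (update Phi s j a) = a by rewrite /update; case: ifP.
have VI_sub : VI (update Phi s j a) \subset VI s :|: vars (Phi j).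
  rewrite /update; case: ifP => _; rewrite ?subxx //=.
  by apply: setUS; apply/subsetP=> v; rewrite inE => /andP[].
split; first by rewrite asgE.
rewrite asgE; have [bad_j|good_j] := boolP (bad a j); last first.
  (* A clause that is not bad falls under Case 1, and [V_I] can gain only [x]. *)
  exists T; split=> //; move: good_j; rewrite /bad pend_a eqxx /= negb_or negbK.
  move=> /andP[agree sat_j]; rewrite /update sat_j subUset cov /=.
  apply/subsetP=> v; rewrite inE => /andP[vj av].
  by have /existsPn/(_ v) := agree; rewrite vj av andbT negbK in_setU1 => ->.
(* A bad clause meeting [T] has its variables already covered; a bad clause disjoint from [T] is
   added to it. *)
have [|disj] := boolP (has (meets Phi j) T).
  case/hasP=> t tT jt; exists T; split=> //; apply: subset_trans VI_sub _.
  rewrite subUset cov; apply/subsetP=> v vj; apply/coveredP; right.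
  by exists t, j.
have {}disj : all (fun i => ~~ meets Phi j i) T by rewrite all_predC.
exists (j :: T); split; rewrite /= ?bad_j //; last first.
  apply: subset_trans VI_sub _; rewrite subUset; apply/andP; split.
    apply: subset_trans cov _; apply/subsetP=> v /coveredP h; apply/coveredP.
    case: h => [->|[t [c [tT ct vc]]]]; [by left | right].
    by exists t, c; rewrite inE tT orbT.
  apply/subsetP=> v vj; apply/coveredP; right; exists j, j.
  by rewrite mem_head; split=> //; exact: (common_var_meets vj vj).
(* Eligibility gives a variable [v] of [j] in [V_I]. It lies in a clause [c] meeting some member of
   [T], and [c] is the middle of the step of distance two, unless [v] is [x]. *)
rewrite wT disj !andbT; move: js; rewrite inE => /and3P[_ /set0Pn[v] + _].
rewrite inE => /andP[vj /(subsetP cov)/coveredP h].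
case: ifP => [/nilP T0|/negbT nT].
  by case: h => [<- //|[t [c []]]]; rewrite T0.
case: h => [vx|[t [c [tT ct vc]]]].
  (* If [v] is [x], then [j] meets the clause of [T] containing [x], against disjointness. *)
  have [t tT xt] := witness_root wT nT.
  by have /allP/(_ t tT)/negP[] := disj; apply: common_var_meets xt; rewrite -vx.
apply/hasP; exists t => //; apply/existsP; exists c.
by rewrite meets_sym ct (common_var_meets vc vj).
Qed.

(** * The law of the run and the union bound over walks *)

Definition law N : {ffun state n m -> R} :=
  iter N (fun mu => bind mu step) (dirac R (init m x)).

Lemma step_ge0 s s' : 0 <= step s s'.
Proof.
rewrite /Defs.step; case: (next_clause s) => [j|]; last by rewrite ffunE.
by rewrite ffunE sumr_ge0 // => a _; rewrite mulr_ge0 ?couple_vars_ge0 // ffunE.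
Qed.

Lemma law_ge0 N s : 0 <= law N s.
Proof.
elim: N s => [|N IH] s /=; first by rewrite ffunE.
by rewrite ffunE sumr_ge0 // => z _; rewrite mulr_ge0 ?IH ?step_ge0.
Qed.

Lemma bind_supp (T U : finType) (mu : {ffun T -> R}) (g : T -> {ffun U -> R}) u :
  bind mu g u != 0 -> exists z, mu z != 0 /\ g z u != 0.
Proof.
rewrite ffunE => nz; have [z] : exists z, mu z * g z u != 0.
  apply/existsP; apply: contraR nz => /existsPn all0; apply/eqP/big1 => z _.
  by have /negbNE/eqP := all0 z.
by rewrite mulf_eq0 negb_or => /andP[? ?]; exists z.
Qed.

Lemma dirac_supp (T : finType) (z u : T) : dirac R z u != 0 -> u = z.
Proof. by rewrite ffunE; have [|_] := eqVneq u z; rewrite /= ?mulr0n ?eqxx. Qed.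

Lemma step_inv s s' : run_inv s -> step s s' != 0 -> run_inv s'.
Proof.
move=> inv_s; rewrite /Defs.step; have := clause_rule s.
case: (next_clause s) => [j js|_ /dirac_supp -> //].
by move=> /bind_supp[a [sup /dirac_supp ->]]; apply: update_inv.
Qed.

Lemma law_inv N s : law N s != 0 -> run_inv s.
Proof.
elim: N s => [|N IH] s; first by move=> /dirac_supp ->; exact: init_inv.
by move=> /bind_supp[z [/IH inv_z]]; apply: step_inv.
Qed.

Context (e : R).
Hypothesis e_ge0 : 0 <= e.
Hypothesis near_half : forall (a : passignment n) y,
  ~: unset a \subset x |: marked -> y \in unset a ->
  `|prob_true R Phi a y - 1 / 2| <= e.
Local Notation pot_prod := (potential_prod Phi x marked e).

Lemma Ex_step_potential_prod T s :
  pairwise (fun i j => ~~ meets Phi i j) T -> run_inv s ->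
  Ex (step s) (fun s' => pot_prod T (asg s')) <= pot_prod T (asg s).
Proof.
move=> pw [adm _]; rewrite /Defs.step; case: (next_clause s) => [j|]; last first.
  by rewrite Ex_dirac.
rewrite Ex_bind; apply: (@le_trans _ _ (Ex (couple_vars R Phi (var_order s j) (asg s))
    (pot_prod T))).
  apply: ler_Ex => [a|a _]; first exact: couple_vars_ge0.
  by rewrite Ex_dirac /update; case: ifP.
apply: Ex_couple_vars_potential_prod => //.
- by rewrite (perm_uniq (order_rule s j)) enum_uniq.
- by move=> v; rewrite mem_var_order in_setI => /andP[].
- by move=> v; rewrite mem_var_order !in_setI => /andP[/andP[]].
Qed.

Lemma Ex_law_potential_prod T N :
  pairwise (fun i j => ~~ meets Phi i j) T ->
  Ex (law N) (fun s => pot_prod T (asg s)) <= pot_prod T (asg (init m x)).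
Proof.
move=> pw; elim: N => [|N IH]; first by rewrite Ex_dirac.
rewrite /law /= -/(law N) Ex_bind; apply: le_trans IH.
apply: ler_Ex => [s|s /law_inv inv_s]; first exact: law_ge0.
exact: Ex_step_potential_prod.
Qed.

Context (B d t : nat) (p : R).
Hypothesis size_le : forall j, (#|vars (Phi j)| <= B)%N.
Hypothesis degree_le : forall v, (#|[set j | v \in vars (Phi j)]| <= d)%N.
Hypothesis potential_init :
  forall j, potential x marked e (Phi j) (asg (init m x)) <= p.

Definition rooted_walks : seq (seq 'I_m) :=
  [seq j :: w | j <- enum [set j | x \in vars (Phi j)], w <- walks Phi (2 * t) j].

(** A walk revisits clauses when it backtracks; [undup] recovers the family of [t + 1] disjoint
    clauses, reached in [2 * t] steps. *)
Definition good_walk (w : seq 'I_m) : bool :=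
  pairwise (fun i j => ~~ meets Phi i j) (undup w) && (size (undup w) == t.+1).

Lemma size_rooted_walks : (size rooted_walks <= d * ((B * d) ^ 2) ^ (2 * t))%N.
Proof.
rewrite size_allpairs_dep sumnE big_map.
set S := [set j | _]; apply: (@leq_trans (\sum_(i <- enum S) ((B * d) ^ 2) ^ (2 * t))).
  by apply: leq_sum => i _; apply: size_walks; apply: card_near.
by rewrite big_const_seq count_predT iter_addn_0 mulnC leq_mul2r -cardE degree_le orbT.
Qed.

Lemma large_VI_walk s : run_inv s -> (1 + t * (B * d * B) < #|VI s|)%N ->
  exists2 w, w \in rooted_walks & good_walk w /\ 1 <= pot_prod (undup w) (asg s).
Proof.
move=> [_ [T0 [wT0 bad0 cov]]] VI_gt.
have T0_gt : (t < size T0)%N.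
  rewrite ltnNge; apply/negP=> T0_le.
  have := leq_trans VI_gt (leq_trans (subset_leq_card cov) (card_covered T0 size_le degree_le)).
  by rewrite ltn_add2l ltnNge leq_mul2r T0_le orbT.
(* The [t + 1] earliest clauses of the family are kept. *)
pose T := drop (size T0 - t.+1) T0.
have wT : witness Phi x T by apply: witness_drop.
have size_T : size T = t.+1 by rewrite size_drop subKn.
have badT : all (bad (asg s)) T.
  by apply/allP=> i /mem_drop; apply: (allP bad0).
have pwT := witness_pairwise wT.
have uniq_T : uniq T.
  apply: pairwise_uniq pwT => i; apply/negbF.
  by have /set0Pn[v vj] := vars_neq0 i; exact: (common_var_meets vj vj).
have [|j [w [xj pw size_w mem_w]]] := witness_walk wT; first by rewrite /nilp size_T.
have perm_w : perm_eq (undup (j :: w)) T.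
  by apply: uniq_perm; rewrite ?undup_uniq // => i; rewrite mem_undup mem_w.
exists (j :: w).
  apply/allpairsPdep; exists j, w; rewrite mem_enum inE xj; split => //.
  by have := mem_walks pw; rewrite size_w size_T.
split; last first.
  rewrite /potential_prod big_seq; elim/big_ind: _ => // [y z|i].
    exact: mulr_ege1.
  by rewrite mem_undup mem_w => /(allP badT); apply: bad_potential.
rewrite /good_walk (perm_size perm_w) size_T eqxx andbT.
apply: perm_pairwise pwT; last by rewrite perm_sym.
by move=> i i'; rewrite meets_sym.
Qed.

(** Markov's inequality: the event is dominated by the sum of the potential products over all rooted
    walks, and each expectation is at most its initial value. *)
Lemma process_bound N : 0 <= p ->
  Pr (law N) (fun s => 1 + t * (B * d * B) < #|VI s|)%N
  <= (d * ((B * d) ^ 2) ^ (2 * t))%:R * p ^+ t.+1.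
Proof.
(* Other walks count for 0, since the supermartingale bound needs disjoint clauses and the exponent
   needs exactly [t + 1] of them. *)
move=> p_ge0; pose F w (s : state n m) := if good_walk w then pot_prod (undup w) (asg s) else 0.
have F_ge0 w s : 0 <= F w s by rewrite /F; case: ifP => // _; apply: potential_prod_ge0.
apply: (@le_trans _ _ (Ex (law N) (fun s => \sum_(w <- rooted_walks) F w s))).
  rewrite /Pr big_mkcond; apply: ler_sum => s _.
  have sum_ge0 : 0 <= \sum_(w <- rooted_walks) F w s by apply: sumr_ge0.
  case: ifP => [VI_gt|_]; last by rewrite mulr_ge0 ?law_ge0.
  have [->|/law_inv inv_s] := eqVneq (law N s) 0; first by rewrite mul0r.
  have [w wW [good pot_w]] := large_VI_walk inv_s VI_gt.
  rewrite -[leLHS]mulr1 ler_wpM2l ?law_ge0 // (le_trans pot_w) //.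
  rewrite (perm_big _ (perm_to_rem wW)) big_cons /= {1}/F good lerDl.
  exact: sumr_ge0.
rewrite /Ex; under eq_bigr => s _ do rewrite mulr_sumr.
rewrite exchange_big /=.
apply: (@le_trans _ _ (\sum_(w <- rooted_walks) p ^+ t.+1)); last first.
  rewrite big_const_seq count_predT iter_addr_0 -[leLHS]mulr_natl.
  by rewrite ler_wpM2r ?exprn_ge0 // ler_nat size_rooted_walks.
apply: ler_sum => w _; rewrite -/(Ex (law N) (F w)) /F.
case: (boolP (good_walk w)) => [/andP[pw /eqP size_w]|_]; last first.
  by rewrite /Ex big1 ?exprn_ge0 // => s _; rewrite mulr0.
apply: le_trans (Ex_law_potential_prod N pw) _.
rewrite /potential_prod -size_w -count_predT -iter_mulr_1 -big_const_seq.
by apply: ler_prod => j _; rewrite potential_ge0 ?potential_init.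
Qed.

End Run.

(** * Numerical estimates *)

Lemma log2_nat_ge0 (R : realType) (n : nat) : 0 <= log2 (n%:R : R).
Proof.
have ln2 : 0 < ln 2 :> R by rewrite ln_gt0 // ltr1n.
case: n => [|n]; first by rewrite /log2 ln0 ?mul0r.
by rewrite /log2 divr_ge0 ?(ltW ln2) // ln_ge0 // ler1n.
Qed.

(** This is the hypothesis on [k] exponentiated: [250 = 50 * 5] and [32 = 2 ^ 5]. *)
Lemma exp2_ge (R : realType) (k d : nat) : (0 < k)%N -> (0 < d)%N ->
  (k%:R : R) >= 50 * log2 (d%:R : R) + 50 * log2 (k%:R : R) + 250 ->
  ((32 * d * k) ^ 50 <= 2 ^ k)%N.
Proof.
move=> k0 d0; have ln2 : 0 < ln 2 :> R by rewrite ln_gt0 // ltr1n.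
rewrite -(ler_pM2r ln2) /log2 => h.
rewrite -(ler_nat R) -ler_ln ?posrE ?ltr0n ?expn_gt0 ?muln_gt0 ?k0 ?d0 //.
rewrite !natrX !lnXn ?ltr0n ?muln_gt0 ?k0 ?d0 //.
have ln32 : ln 32 = 5 * ln 2 :> R.
  by rewrite (_ : 32 = 2 ^+ 5) ?lnXn // -?natrX // mulr_natl.
rewrite !natrM !lnM ?posrE ?mulr_gt0 ?ltr0n // ln32.
rewrite -[leLHS]mulr_natl -[leRHS]mulr_natl; move: h.
have -> : (50 * (ln d%:R / ln 2) + 50 * (ln k%:R / ln 2) + 250) * ln 2
          = 50 * ln d%:R + 50 * ln k%:R + 250 * ln 2 :> R.
  by field; rewrite gt_eqF.
set L2 := ln 2; set Ld := ln d%:R; set Lk := ln k%:R => h.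
lra.
Qed.

(** Fourth roots of [N ^ 48 <= N ^ 50 <= 2 ^ (4 * u.+1)] give [N ^ 12 <= 2 ^ u.+1]; one factor [N]
    then pays for the extra 2. *)
Lemma exp2_quarter_ge (N k u : nat) : (32 <= N)%N -> (N ^ 50 <= 2 ^ k)%N ->
  (k <= 4 * u.+1)%N -> (N ^ 11 <= 2 ^ u)%N.
Proof.
move=> N_ge Nk k_le.
have N12 : (N ^ 12 <= 2 ^ u.+1)%N.
  rewrite -(@leq_exp2r _ _ 4) // -!expnM.
  apply: (@leq_trans (N ^ 50)); first by rewrite leq_exp2l //; lia.
  by rewrite (leq_trans Nk) // leq_exp2l // mulnC.
rewrite -(@leq_pmul2l 2) // -expnS; apply: leq_trans N12.
by rewrite (expnS N 11) leq_mul2r (leq_trans _ N_ge) ?orbT.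
Qed.

Lemma bias_le (R : realType) (d N u : nat) : (0 < N)%N -> (2 * d <= N)%N ->
  (N ^ 11 <= 2 ^ u)%N -> (2 * d)%:R / (2 ^ u)%:R <= (N ^ 10)%:R^-1 :> R.
Proof.
move=> N0 dN Nu; have E0 : (0 < 2 ^ u)%N by rewrite expn_gt0.
rewrite ler_pdivrMr ?ltr0n // mulrC ler_pdivlMr ?ltr0n ?expn_gt0 ?N0 //.
rewrite -natrM ler_nat (leq_trans _ Nu) // (expnS N 10).
by rewrite leq_mul2r dN orbT.
Qed.

Lemma biased_power_le (R : realType) (e : R) (N u : nat) :
  (0 < N)%N -> (N ^ 11 <= 2 ^ u)%N -> 0 <= e -> e <= 1 / 10 ->
  (1 / 2 + e) ^+ u <= (N ^ 7)%:R^-1.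
Proof.
move=> N0 Nu e0 e1; set q := 1 / 2 + e.
have q0 : 0 <= q by rewrite addr_ge0 ?divr_ge0.
have q1 : q <= 3 / 5 by rewrite /q; lra.
(* Cubing works because [(3 / 5) ^ 3 < 1 / 4]: the cube of the left side is at most
   [4 ^ (- u) <= N ^ (- 22)], and [N ^ (- 21)] is enough. *)
rewrite -(@ler_pXn2r _ 3) ?nnegrE ?exprn_ge0 ?invr_ge0 ?ler0n //.
have q3 : q ^+ 3 <= (2 ^+ 2)^-1.
  apply: (@le_trans _ _ ((3 / 5) ^+ 3)); last by lra.
  by rewrite ler_pXn2r ?nnegrE ?divr_ge0.
rewrite exprAC; apply: (@le_trans _ _ ((2 ^+ 2)^-1 ^+ u)).
  by apply: lerXn2r => //; rewrite nnegrE ?invr_ge0 exprn_ge0.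
rewrite !exprVn exprAC -!natrX lef_pV2 ?posrE ?ltr0n ?expn_gt0 ?N0 //.
rewrite ler_nat; apply: (@leq_trans ((N ^ 11) ^ 2)); last by rewrite leq_exp2r.
by rewrite -!expnM leq_pexp2l.
Qed.

(** Initially only [x] is set, so at least [u] marked variables of [c] are pending; the final factor
    2 allows for both sides being unsatisfied. *)
Lemma potential_init_le (R : realType) (n m : nat) (x : 'I_n)
    (marked : {set 'I_n}) (e : R) (u B : nat) (c : clause n) :
  0 <= e -> e <= 1 / 2 -> (u < #|vars c :&: marked|)%N -> (#|vars c| <= B)%N ->
  potential x marked e c (asg (init m x))
    <= 2 * e * B%:R + 2 * (1 / 2 + e) ^+ u.
Proof.
move=> e0 e1 u_lt B_ge; rewrite /potential.
have /negbTE -> : ~~ disagrees x c (asg (init m x)).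
  apply/existsPn=> v; rewrite /asg /= !ffunE.
  by case: (v =P x); rewrite ?eqxx ?andbF.
set r := #|_|.
have r_le : (r <= B)%N.
  apply: leq_trans B_ge; apply/subset_leq_card/subsetP=> v.
  by rewrite !in_setI => /andP[/andP[]].
have r_ge : (u <= r)%N.
  rewrite -ltnS; apply: leq_trans u_lt _; rewrite (cardsD1 x).
  apply: (@leq_trans (1 + #|(vars c :&: marked) :\ x|)).
    by rewrite leq_add2r leq_b1.
  rewrite ltnS; apply/subset_leq_card/subsetP=> v.
  rewrite in_setD1 => /andP[vx vc]; rewrite in_setI vc /=.
  by rewrite inE !ffunE (negbTE vx).
rewrite add0r lerD //; first by rewrite ler_wpM2l ?mulr_ge0 // ler_nat.
have q0 : 0 <= 1 / 2 + e by rewrite addr_ge0 ?divr_ge0.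
rewrite mulrC ler_pM ?addr_ge0 ?exprn_ge0 //.
  by case: (~~ _); case: (~~ _); rewrite /= ?mulr0n ?mulr1n; lra.
by apply: ler_wiXn2l => //; lra.
Qed.

Lemma potential_numeric (R : realType) (e : R) (k d u : nat) (N := (32 * d * k)%N) :
  (0 < k)%N -> (0 < d)%N -> 0 <= e -> e <= (N ^ 10)%:R^-1 ->
  (1 / 2 + e) ^+ u <= (N ^ 7)%:R^-1 ->
  2 * e * (6 * k)%:R + 2 * (1 / 2 + e) ^+ u <= (2 * (6 * k * d) ^ 5)%:R^-1.
Proof.
move=> k0 d0 e0 e1 qu.
have N_ge : (32 <= N)%N by rewrite /N; nia.
(* The disagreement term contributes one [N ^ (- 7)] and the unsatisfied sides two. Below, [N ^ 2]
   absorbs the constant 6 and [N ^ 5] dominates [(6 * k * d) ^ 5]. *)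
apply: (@le_trans _ _ (3 * (N ^ 7)%:R^-1)).
  have : 2 * e * (6 * k)%:R <= (N ^ 7)%:R^-1.
    apply: (@le_trans _ _ (2 * (N ^ 10)%:R^-1 * (6 * k)%:R)).
      by rewrite ler_wpM2r // ler_wpM2l.
    rewrite -[2 * _ * _]mulrAC -natrM ler_pdivrMr ?ltr0n ?expn_gt0 ?(leq_trans _ N_ge) //.
    rewrite mulrC ler_pdivlMr ?ltr0n ?expn_gt0 ?(leq_trans _ N_ge) //.
    rewrite -natrM ler_nat (expnD N 3 7) leq_mul2r; apply/orP; right.
    apply: (@leq_trans N); first by rewrite /N; nia.
    by rewrite -[leqLHS]expn1 leq_pexp2l //; lia.
  by lra.
have M_pos : (0 < 6 * k * d)%N by rewrite !muln_gt0 k0 d0.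
rewrite ler_pdivrMr ?ltr0n ?expn_gt0 ?(leq_trans _ N_ge) //.
have M5_pos : (0 < 2 * (6 * k * d) ^ 5)%N by rewrite muln_gt0 expn_gt0 M_pos.
rewrite mulrC ler_pdivlMr ?ltr0n // -natrM ler_nat (expnD N 2 5) mulnA leq_mul //.
  by apply: (@leq_trans (32 ^ 2)) => //; rewrite leq_exp2r.
by rewrite leq_exp2r // /N; nia.
Qed.

(** The root and the [2 * t] steps give at most [M ^ (4 * t + 1)] walks, which the factor
    [M ^ (5 * (t + 1))] in the denominator outweighs. *)
Lemma walk_count_le (R : realType) (d M t : nat) (p := (2 * M ^ 5)%:R^-1 : R) :
  (0 < M)%N -> (d <= M)%N ->
  (d * (M ^ 2) ^ (2 * t))%:R * p ^+ t.+1 <= (1 / 2) ^+ t.+1.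
Proof.
move=> M0 dM; rewrite /p exprVn -natrX div1r exprVn -natrX.
have M5_pos : (0 < 2 * M ^ 5)%N by rewrite muln_gt0 expn_gt0 M0.
rewrite ler_pdivrMr ?ltr0n ?expn_gt0 ?M5_pos //.
rewrite mulrC ler_pdivlMr ?ltr0n ?expn_gt0 // -natrM ler_nat.
rewrite expnMn [leqRHS]mulnC leq_mul2r -!expnM; apply/orP; right.
apply: (@leq_trans (M ^ (1 + 2 * (2 * t)))).
  by rewrite expnD expn1 leq_mul2r dM orbT.
by rewrite leq_pexp2l //; lia.
Qed.

(** * Choice of the parameters and conclusion *)

Theorem theorem3p14 (R : realType) (n m k d : nat) (Phi : cnf n m) (x : 'I_n)
    (marked : {set 'I_n})
    (next_clause : state n m -> option 'I_m)
    (var_order : state n m -> 'I_m -> seq 'I_n)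
    (clause_size : forall j : 'I_m, (k <= #|vars (Phi j)| <= 6 * k)%N)
    (var_degree : forall v : 'I_n,
       (#|[set j : 'I_m | v \in vars (Phi j)]| <= d)%N)
    (log_d : log2 (d%:R : R) >= 5 * log2 (k%:R : R) + 20)
    (k_large : (k%:R : R) >=
       50 * log2 (d%:R : R) + 50 * log2 (k%:R : R) + 250)
    (many_marked : forall j : 'I_m,
       (k%:R : R) / 4 <= #|vars (Phi j) :&: marked|%:R)
    (many_unmarked : forall j : 'I_m,
       (k%:R : R) / 4 <= #|vars (Phi j) :\: marked|%:R)
    (clause_rule : valid_clause_rule Phi next_clause)
    (order_rule : valid_var_order Phi marked var_order)
    (t : nat) (t_gt0 : (0 < t)%N) :
  Pr (final_law R Phi x next_clause var_order)
     (fun s => (2 * (6 * d * k) ^ 2 * t <= #|VI s|)%N) <= (1 / 2) ^+ t.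
Proof.
have log_k := log2_nat_ge0 R k.
(* By convention [ln 0 = 0], so [d = 0] would make the lower bound 20 on [log2 d] fail; [k = 0]
   contradicts [k_large] likewise. *)
have d0 : (0 < d)%N.
  have log0 : log2 (0%:R : R) = 0 by rewrite /log2 ln0 ?mul0r.
  by case: d log_d {var_degree k_large} => //; rewrite log0; lra.
have k0 : (0 < k)%N.
  case: k k_large log_d log_k {clause_size many_marked many_unmarked} => //; lra.
(* This [u] is the largest integer strictly below [k / 4], which leaves room for losing [x]. *)
pose u := (k.-1 %/ 4)%N; pose N := (32 * d * k)%N.
have quarter (r : nat) : (k%:R : R) / 4 <= r%:R -> (u < r)%N.
  rewrite ler_pdivrMr // -natrM ler_nat /u; lia.
have N_ge : (32 <= N)%N by rewrite /N; nia.
have Nu : (N ^ 11 <= 2 ^ u)%N.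
  apply: (exp2_quarter_ge N_ge (exp2_ge k0 d0 k_large)); rewrite /u; lia.
pose e : R := (2 * d)%:R / (2 ^ u)%:R.
have e_ge0 : 0 <= e by rewrite divr_ge0.
have e_le : e <= (N ^ 10)%:R^-1 by apply: bias_le => //; rewrite /N; nia.
have e_small : e <= 1 / 10.
  apply: le_trans e_le _; rewrite div1r lef_pV2 ?posrE ?ltr0n ?expn_gt0 ?(leq_trans _ N_ge) //.
  by rewrite ler_nat (leq_trans (_ : 10 <= 32 ^ 10)%N) // leq_exp2r.
have size_le j : (#|vars (Phi j)| <= 6 * k)%N by have /andP[] := clause_size j.
have vars0 j : vars (Phi j) != set0.
  by rewrite -card_gt0 (leq_trans k0) //; have /andP[] := clause_size j.
have near_half (a : passignment n) y : ~: unset a \subset x |: marked ->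
    y \in unset a -> `|prob_true R Phi a y - 1 / 2| <= e.
  apply: (@prob_true_near_half R n m u (6 * k) d) => //.
  - by move=> j; apply: quarter.
  - by rewrite muln_gt0 k0.
  - apply: leq_trans Nu; apply: (@leq_trans N); first by rewrite /N; nia.
    by rewrite -[leqLHS]expn1 leq_pexp2l //; lia.
pose p : R := (2 * (6 * k * d) ^ 5)%:R^-1.
have pot_le j : potential x marked e (Phi j) (asg (init m x)) <= p.
  apply: (@le_trans _ _ (2 * e * (6 * k)%:R + 2 * (1 / 2 + e) ^+ u)).
    by apply: potential_init_le => //; [lra | apply: quarter].
  apply: potential_numeric => //; apply: biased_power_le => //; lia.
(* With [t] now the predecessor, walks of [2 * t] steps carry [t + 1] clauses, which gives the
   exponent [t + 1]. *)
case: t t_gt0 => // t _.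
have M0 : (0 < 6 * k * d)%N by rewrite !muln_gt0 k0 d0.
have dM : (d <= 6 * k * d)%N by nia.
apply: le_trans (walk_count_le R t M0 dM).
apply: le_trans (process_bound clause_rule order_rule vars0 e_ge0 near_half t
  size_le var_degree pot_le m _); last by rewrite invr_ge0.
rewrite /Pr [leLHS]big_mkcond [leRHS]big_mkcond; apply: ler_sum => s _.
case: ifP => [VI_ge|_]; last by case: ifP => // _; apply: law_ge0.
(* The threshold [2 * (6 * d * k) ^ 2 * (t + 1)] exceeds [1 + t * (36 * k ^ 2 * d)], the size that
   [t] clauses can cover. *)
rewrite ifT //; apply: leq_trans VI_ge; clear -k0 d0; nia.
Qed.
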